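(* Let $H$ be a Heyting algebra. Then there exist a KM-algebra $(K,\Delta)$ and a one-to-one Heyting algebra homomorphism $H\to K$ such that the Heyting algebra reduct $K$ belongs to the variety of Heyting algebras generated by $H$.
   Context: A KM-algebra is a Heyting algebra $(K,\land,\lor,\to,0,1)$ together with a unary operation $\Delta$ satisfying, for all $x,y\in K$: $x\le\Delta x$, $(\Delta x\to x)=x$, and $\Delta x\le y\lor(y\to x)$. The variety generated by $H$ is the class of Heyting algebras that are homomorphic images of subalgebras of direct powers of $H$. (In the paper this is shown for a specific algebra $H^{\mathrm{KM}}$ obtained as a direct limit of iterated free adjunctions of elements $\Delta(a)$.) *)

(* Defs.v *)
From HB Require Import structures.
From mathcomp Require Import all_boot all_order.
From mathcomp Require Import boolp.

Set Implicit Arguments.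
Unset Strict Implicit.
Unset Printing Implicit Defensive.

Import Order.TTheory.
Local Open Scope order_scope.

Reserved Notation "x `=>` y" (at level 55, right associativity).

HB.mixin Record TBDistrLattice_isHeyting d T of Order.TBDistrLattice d T := {
  himp : T -> T -> T;
  leIhimp : forall x y z : T, (x `&` y <= z) = (x <= himp y z)
}.

#[short(type="heytingType")]
HB.structure Definition Heyting d :=
  {T of Order.TBDistrLattice d T & TBDistrLattice_isHeyting d T}.

Notation "x `=>` y" := (himp x y) : order_scope.

HB.mixin Record Heyting_isKM d T of Heyting d T := {
  delta : T -> T;
  le_delta : forall x : T, x <= delta x;
  delta_himp : forall x : T, (delta x `=>` x) = x;
  delta_le : forall x y : T, delta x <= y `|` (y `=>` x)
}.

#[short(type="kmType")]
HB.structure Definition KM d := {T of Heyting d T & Heyting_isKM d T}.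

Record heyting_hom d (A : heytingType d) d' (B : heytingType d')
    (f : A -> B) : Prop := HeytingHom {
  heyting_homI : Order.meet_morphism f;
  heyting_homU : Order.join_morphism f;
  heyting_hom_imp : {morph f : x y / x `=>` y};
  heyting_hom0 : f \bot = \bot;
  heyting_hom1 : f \top = \top
}.

(* The direct power [I -> H]; the library provides its pointwise order, meet
   and join. *)
Section Power.
Variables (I : Type) (d : Order.disp_t) (H : heytingType d).
Implicit Types f g h : I -> H.

Fact power_le0x f : (fun=> \bot) <= f.
Proof. by apply/lefP => i; exact: le0x. Qed.

Fact power_lex1 f : f <= (fun=> \top).
Proof. by apply/lefP => i; exact: lex1. Qed.

HB.instance Definition _ :=
  Order.hasBottom.Build FunOrder.fun_display (I -> H) power_le0x.
HB.instance Definition _ :=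
  Order.hasTop.Build FunOrder.fun_display (I -> H) power_lex1.

Fact power_meetUl : left_distributive (@Order.meet _ (I -> H)) Order.join.
Proof. by move=> f g h; apply/funext => i; exact: meetUl. Qed.

HB.instance Definition _ :=
  Order.Lattice_Meet_isDistrLattice.Build FunOrder.fun_display (I -> H)
    power_meetUl.

Definition power_himp f g : I -> H := fun i => f i `=>` g i.

Fact power_leIhimp f g h : (f `&` g <= h) = (f <= power_himp g h).
Proof. by apply/lefP/lefP => le_fgh i; have := le_fgh i; rewrite leIhimp. Qed.

HB.instance Definition _ :=
  TBDistrLattice_isHeyting.Build FunOrder.fun_display (I -> H) power_leIhimp.

End Power.

Record heyting_closed d (A : heytingType d) (S : {pred A}) : Prop :=
  HeytingClosed {
    heyting_closedI : {in S &, forall x y, x `&` y \in S};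
    heyting_closedU : {in S &, forall x y, x `|` y \in S};
    heyting_closed_imp : {in S &, forall x y, x `=>` y \in S};
    heyting_closed0 : \bot \in S;
    heyting_closed1 : \top \in S
  }.

Section Subalgebra.
Variables (d : Order.disp_t) (A : heytingType d) (S : {pred A}).

Definition subalgebra (clS : heyting_closed S) : Type := {x : A | x \in S}.

Variable clS : heyting_closed S.
Local Notation B := (subalgebra clS).
Implicit Types x y z : B.

HB.instance Definition _ := SubChoice.on B.
HB.instance Definition _ :=
  Order.SubChoice_isTBSubLattice.Build d A (mem S) d B
    (heyting_closedI clS) (heyting_closedU clS)
    (heyting_closed0 clS) (heyting_closed1 clS).

Fact subalgebra_valI x y : \val (x `&` y) = \val x `&` \val y.
Proof. by []. Qed.

Fact subalgebra_valU x y : \val (x `|` y) = \val x `|` \val y.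
Proof. by []. Qed.

Fact subalgebra_meetUl x y z : (x `|` y) `&` z = (x `&` z) `|` (y `&` z).
Proof.
apply: val_inj.
by rewrite !(subalgebra_valI, subalgebra_valU) meetUl.
Qed.

HB.instance Definition _ :=
  Order.Lattice_Meet_isDistrLattice.Build d B subalgebra_meetUl.

Definition subalgebra_himp x y : B :=
  exist _ (val x `=>` val y) (heyting_closed_imp clS (valP x) (valP y)).

Fact subalgebra_leIhimp x y z :
  (x `&` y <= z) = (x <= subalgebra_himp y z).
Proof. exact: leIhimp. Qed.

HB.instance Definition _ :=
  TBDistrLattice_isHeyting.Build d B subalgebra_leIhimp.

End Subalgebra.

Definition in_variety_generated_by d (H : heytingType d)
    d' (K : heytingType d') : Prop :=
  exists (I : Type) (S : {pred I -> H}) (clS : heyting_closed S)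
         (g : subalgebra clS -> K),
    heyting_hom g /\ (forall y : K, exists x, g x = y).

(* Main.v *)
(** Writing [D_b] for the elements [y \/ (y -> b)], a value for [Delta b] is an
    element [e] below all of [D_b] with [(e -> b) = b].  Finite meets of
    [D_b] satisfy the second condition, so in the reduced power of [M] over
    finite subsets [F] of [M] (modulo "for all large [F]") the element
    [e F := /\_(y in F) (y \/ (y -> b))] satisfies [e <= y \/ (y -> b)] for
    every [y] of [M].  The same then holds for every [x] of the reduced power
    that agrees with some [h] of [M] modulo the filter of [e]; these [x] form a
    subalgebra containing [M] and [e], in which [e = Delta b].  The conditions
    defining [Delta a = d] are universally quantified inequalities, so the
    values of [Delta] already present in [M] survive in the extension.  Hence
    any finite set of terms [Delta t] can be interpreted in an extension of [H]
    satisfying the identities of [H], and by compactness the algebra of all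
    terms, ordered by the inequalities forced by finitely many [Delta]-axioms,
    is a KM-algebra containing [H]. *)

Require Import Defs.
From HB Require Import structures.
From mathcomp Require Import all_boot all_order.
From mathcomp Require Import generic_quotient.
From mathcomp Require Import boolp.

Set Implicit Arguments.
Unset Strict Implicit.
Unset Printing Implicit Defensive.

Import Order.TTheory.
Local Open Scope order_scope.
Local Open Scope quotient_scope.

(** * Pre-Heyting algebras *)

(* Heyting algebras up to order equivalence: working with them postpones all
   quotients to the last step. *)
Record preheyting := PreHeyting {
  ph_sort :> Type;
  ph_le : ph_sort -> ph_sort -> Prop;
  ph_meet : ph_sort -> ph_sort -> ph_sort;
  ph_join : ph_sort -> ph_sort -> ph_sort;
  ph_imp : ph_sort -> ph_sort -> ph_sort;
  ph_bot : ph_sort;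
  ph_top : ph_sort;
  ph_refl : forall x, ph_le x x;
  ph_trans : forall y x z, ph_le x y -> ph_le y z -> ph_le x z;
  ph_lexI : forall x y z, ph_le x (ph_meet y z) <-> ph_le x y /\ ph_le x z;
  ph_leUx : forall x y z, ph_le (ph_join x y) z <-> ph_le x z /\ ph_le y z;
  ph_leIimp : forall x y z, ph_le (ph_meet x y) z <-> ph_le x (ph_imp y z);
  ph_le0x : forall x, ph_le ph_bot x;
  ph_lex1 : forall x, ph_le x ph_top
}.

Arguments ph_bot {_}.
Arguments ph_top {_}.

Declare Scope ph_scope.
Delimit Scope ph_scope with ph.
Notation "x <= y" := (ph_le x y) : ph_scope.
Notation "x `&` y" := (ph_meet x y) : ph_scope.
Notation "x `|` y" := (ph_join x y) : ph_scope.
Notation "x `=>` y" := (ph_imp x y) : ph_scope.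
Local Open Scope ph_scope.

(** Classical equality and choice give [\in] on sequences over any carrier, and representatives in
    its quotient. *)
HB.instance Definition _ (M : preheyting) := gen_eqMixin (ph_sort M).
HB.instance Definition _ (M : preheyting) := gen_choiceMixin (ph_sort M).

Section PreHeytingTheory.
Variable M : preheyting.
Implicit Types x y z w e h k : M.

Definition ph_eqv x y := x <= y /\ y <= x.

Lemma ph_eqv_refl x : ph_eqv x x.
Proof. by split; exact: ph_refl. Qed.

Lemma ph_eqv_trans y x z : ph_eqv x y -> ph_eqv y z -> ph_eqv x z.
Proof.
by case=> xy yx [yz zy]; split; [exact: ph_trans yz|exact: ph_trans yx].
Qed.

Lemma ph_leIl x y : x `&` y <= x.
Proof. by have /ph_lexI[] := ph_refl (x `&` y). Qed.

Lemma ph_leIr x y : x `&` y <= y.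
Proof. by have /ph_lexI[] := ph_refl (x `&` y). Qed.

Lemma ph_leUl x y : x <= x `|` y.
Proof. by have /ph_leUx[] := ph_refl (x `|` y). Qed.

Lemma ph_leUr x y : y <= x `|` y.
Proof. by have /ph_leUx[] := ph_refl (x `|` y). Qed.

(** Kripke-style reading of implication: later proofs argue about elements below a given one. *)
Lemma ph_le_imp z x y :
  z <= (x `=>` y) <-> forall w, w <= z -> w <= x -> w <= y.
Proof.
rewrite -ph_leIimp; split=> [zxy w wz wx | H].
  by apply: ph_trans zxy; apply/ph_lexI.
by apply: H; [exact: ph_leIl | exact: ph_leIr].
Qed.

Lemma ph_join_elim z x y g : z <= x `|` y ->
  (forall w, w <= z -> w <= x -> w <= g) ->
  (forall w, w <= z -> w <= y -> w <= g) -> z <= g.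
Proof.
move=> zxy Hx Hy.
suff /ph_le_imp : x `|` y <= (z `=>` g) by apply=> //; exact: ph_refl.
by apply/ph_leUx; split; apply/ph_le_imp => w wx wz; [exact: Hx|exact: Hy].
Qed.

(** * Values of Delta and agreement modulo a principal filter *)

Definition is_delta b d :=
  [/\ b <= d, (d `=>` b) <= b & forall y, d <= y `|` (y `=>` b)].

(** Congruence modulo the filter generated by [e]: it says that the meets of [x] and [h] with [e]
    are equivalent. *)
Definition ph_agree e x h := forall z, z <= e -> (z <= x <-> z <= h).

Lemma ph_agree_refl e x : ph_agree e x x.
Proof. by []. Qed.

Lemma ph_agreeI e x h y k :
  ph_agree e x h -> ph_agree e y k -> ph_agree e (x `&` y) (h `&` k).
Proof. by move=> xh yk z ze; rewrite !ph_lexI xh // yk. Qed.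

Lemma ph_agreeU e x h y k :
  ph_agree e x h -> ph_agree e y k -> ph_agree e (x `|` y) (h `|` k).
Proof.
move=> xh yk z ze; split=> zU; apply: (ph_join_elim zU) => w wz wx;
  have we := ph_trans wz ze.
- by apply: ph_trans (ph_leUl _ _); apply/xh.
- by apply: ph_trans (ph_leUr _ _); apply/yk.
- by apply: ph_trans (ph_leUl _ _); apply/xh.
- by apply: ph_trans (ph_leUr _ _); apply/yk.
Qed.

Lemma ph_agree_imp e x h y k :
  ph_agree e x h -> ph_agree e y k -> ph_agree e (x `=>` y) (h `=>` k).
Proof.
move=> xh yk z ze; rewrite !ph_le_imp; split=> H w wz wx;
  have we := ph_trans wz ze.
- by apply/yk => //; apply: H => //; apply/xh.
- by apply/yk => //; apply: H => //; apply/xh.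
Qed.

Lemma ph_agree_top e : ph_agree e e ph_top.
Proof. by move=> z ze; split=> // _; exact: ph_lex1. Qed.

(** Below [e], the element [x \/ (x -> b)] depends only on the class of [x] modulo the filter of
    [e]. *)
Lemma ph_agree_cover e x h b :
  ph_agree e x h -> e <= h `|` (h `=>` b) -> e <= x `|` (x `=>` b).
Proof.
move=> xh ecov; apply: (ph_join_elim ecov) => w we wh.
  by apply: ph_trans (ph_leUl _ _); apply/xh.
apply: ph_trans (ph_leUr _ _); apply/ph_le_imp => v vw vx.
by move/ph_le_imp: wh; apply=> //; apply/xh => //; exact: ph_trans we.
Qed.

End PreHeytingTheory.

(** * The Heyting algebra of a pre-Heyting algebra *)

Section Quotient.
Variables (d : Order.disp_t) (P : preheyting).

Definition ph_eqvb (x y : P) : bool := `[< ph_eqv x y >].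

Fact ph_eqvb_equiv : equiv_class_of ph_eqvb.
Proof.
split=> [x|x y|y x z].
- exact/asboolP/ph_eqv_refl.
- by apply/asboolP/asboolP => -[].
- by move=> /asboolP xy /asboolP yz; apply/asboolP; exact: ph_eqv_trans yz.
Qed.

Canonical ph_eqv_rel := EquivRelPack ph_eqvb_equiv.

(** The display is an argument so that the type itself determines the display of its order
    instances. *)
Definition ph_quot_of (_ : Order.disp_t) : Type := {eq_quot ph_eqv_rel}.
Local Notation ph_quot := (ph_quot_of d).

HB.instance Definition _ := Choice.on ph_quot.

Definition ph_pi (x : P) : ph_quot := \pi_{eq_quot ph_eqv_rel} x.
Definition ph_repr (q : ph_quot) : P := repr (q : {eq_quot ph_eqv_rel}).

Lemma ph_reprK q : ph_pi (ph_repr q) = q.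
Proof. exact: reprK. Qed.

Lemma ph_piP x y : ph_pi x = ph_pi y <-> ph_eqv x y.
Proof. by split=> [/eqquotP /asboolP | xy]; last exact/eqquotP/asboolP. Qed.

Lemma ph_pi_repr x : ph_eqv (ph_repr (ph_pi x)) x.
Proof. by apply/ph_piP; rewrite ph_reprK. Qed.

Definition ph_quot_le (p q : ph_quot) : bool := `[< ph_repr p <= ph_repr q >].

Fact ph_quot_le_refl : reflexive ph_quot_le.
Proof. by move=> q; apply/asboolP; exact: ph_refl. Qed.

Fact ph_quot_le_anti : antisymmetric ph_quot_le.
Proof.
move=> p q /andP[/asboolP pq /asboolP qp].
by rewrite -(ph_reprK p) -(ph_reprK q); apply/ph_piP.
Qed.

Fact ph_quot_le_trans : transitive ph_quot_le.
Proof.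
move=> q p r /asboolP pq /asboolP qr; apply/asboolP; exact: ph_trans qr.
Qed.

HB.instance Definition _ := Order.Le_isPOrder.Build d ph_quot
  ph_quot_le_refl ph_quot_le_anti ph_quot_le_trans.

Lemma le_ph_pi x y : (ph_pi x <= ph_pi y)%O = `[< x <= y >].
Proof.
have [xr rx] := ph_pi_repr x; have [yr ry] := ph_pi_repr y.
apply/asboolP/asboolP => le_xy.
  by apply: ph_trans yr; apply: ph_trans le_xy.
by apply: ph_trans ry; apply: ph_trans le_xy.
Qed.

Definition ph_quot_meet p q := ph_pi (ph_repr p `&` ph_repr q).
Definition ph_quot_join p q := ph_pi (ph_repr p `|` ph_repr q).
Definition ph_quot_himp p q := ph_pi (ph_repr p `=>` ph_repr q).

Fact ph_quot_lexI p q r :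
  (p <= ph_quot_meet q r)%O = ((p <= q) && (p <= r))%O.
Proof.
rewrite -{1 2 3}(ph_reprK p) -{2}(ph_reprK q) -{2}(ph_reprK r) !le_ph_pi.
by rewrite -asbool_and; apply: asbool_equiv_eq; exact: ph_lexI.
Qed.

Fact ph_quot_leUx p q r :
  (ph_quot_join p q <= r)%O = ((p <= r) && (q <= r))%O.
Proof.
rewrite -{2}(ph_reprK p) -{2}(ph_reprK q) -{1 2 3}(ph_reprK r) !le_ph_pi.
by rewrite -asbool_and; apply: asbool_equiv_eq; exact: ph_leUx.
Qed.

HB.instance Definition _ := Order.POrder_MeetJoin_isLattice.Build d ph_quot
  ph_quot_lexI ph_quot_leUx.

Fact ph_quot_le0x q : (ph_pi ph_bot <= q)%O.
Proof.
by rewrite -(ph_reprK q) le_ph_pi; apply/asboolP; exact: ph_le0x.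
Qed.

Fact ph_quot_lex1 q : (q <= ph_pi ph_top)%O.
Proof.
by rewrite -(ph_reprK q) le_ph_pi; apply/asboolP; exact: ph_lex1.
Qed.

HB.instance Definition _ := Order.hasBottom.Build d ph_quot ph_quot_le0x.
HB.instance Definition _ := Order.hasTop.Build d ph_quot ph_quot_lex1.

Fact ph_quot_leIhimp (p q r : ph_quot) :
  (p `&` q <= r)%O = (p <= ph_quot_himp q r)%O.
Proof.
rewrite -[in RHS](ph_reprK p) -[in LHS](ph_reprK r) !le_ph_pi.
by apply: asbool_equiv_eq; exact: ph_leIimp.
Qed.

(** Meet with [r] is left adjoint to implication from [r], hence preserves joins. *)
Fact ph_quot_meetUl : left_distributive (@Order.meet _ ph_quot) Order.join.
Proof.
move=> p q r; apply: le_anti; apply/andP; split.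
  by rewrite ph_quot_leIhimp leUx -!ph_quot_leIhimp leUl leUr.
by rewrite leUx lexI leIr lexI leIr !andbT !(le_trans (leIl _ _)) ?leUl ?leUr.
Qed.

HB.instance Definition _ :=
  Order.Lattice_Meet_isDistrLattice.Build d ph_quot ph_quot_meetUl.
HB.instance Definition _ :=
  TBDistrLattice_isHeyting.Build d ph_quot ph_quot_leIhimp.

Lemma ph_piI x y : (ph_pi (x `&` y)%ph = ph_pi x `&` ph_pi y)%O.
Proof.
have [xr rx] := ph_pi_repr x; have [yr ry] := ph_pi_repr y.
apply/ph_piP; split; apply/ph_lexI; split.
- exact: ph_trans (ph_leIl _ _) rx.
- exact: ph_trans (ph_leIr _ _) ry.
- exact: ph_trans (ph_leIl _ _) xr.
- exact: ph_trans (ph_leIr _ _) yr.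
Qed.

Lemma ph_piU x y : (ph_pi (x `|` y)%ph = ph_pi x `|` ph_pi y)%O.
Proof.
have [xr rx] := ph_pi_repr x; have [yr ry] := ph_pi_repr y.
apply/ph_piP; split; apply/ph_leUx; split.
- exact: ph_trans rx (ph_leUl _ _).
- exact: ph_trans ry (ph_leUr _ _).
- exact: ph_trans xr (ph_leUl _ _).
- exact: ph_trans yr (ph_leUr _ _).
Qed.

Lemma ph_pi_imp x y : (ph_pi (x `=>` y)%ph = (ph_pi x `=>` ph_pi y))%O.
Proof.
have [xr rx] := ph_pi_repr x; have [yr ry] := ph_pi_repr y.
apply/ph_piP; split; apply/ph_le_imp => w /ph_le_imp wxy wx.
- by apply: ph_trans ry; apply: wxy; [exact: ph_refl|exact: ph_trans xr].
- by apply: ph_trans yr; apply: wxy; [exact: ph_refl|exact: ph_trans rx].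
Qed.

End Quotient.

(** * Terms and their evaluation *)

Inductive kmterm (A : Type) :=
  | Cst of A
  | Dlt of kmterm A
  | Meet of kmterm A & kmterm A
  | Join of kmterm A & kmterm A
  | Imp of kmterm A & kmterm A
  | Bot
  | Top.

Arguments Bot {A}.
Arguments Top {A}.

HB.instance Definition _ (A : Type) := gen_eqMixin (kmterm A).

(** Nesting depth of [Dlt]: if [Dlt s] occurs in [t], then [s] has smaller size than [t]. *)
Fixpoint tsize A (t : kmterm A) : nat :=
  match t with
  | Cst _ | Bot | Top => 0
  | Dlt t => (tsize t).+1
  | Meet t s | Join t s | Imp t s => maxn (tsize t) (tsize s)
  end.

(* A term [Dlt t] is evaluated as a variable indexed by the syntax of [t]. *)
Fixpoint teval A (M : preheyting) (c : A -> M) (dl : kmterm A -> M)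
    (t : kmterm A) : M :=
  match t with
  | Cst a => c a
  | Dlt t => dl t
  | Meet t s => teval c dl t `&` teval c dl s
  | Join t s => teval c dl t `|` teval c dl s
  | Imp t s => teval c dl t `=>` teval c dl s
  | Bot => ph_bot
  | Top => ph_top
  end.

(** * Adjoining one value of Delta *)

Section Adjoin.
Variables (M : preheyting) (b : M).

(** The filter of the reduced power; sequences stand for finite subsets of [M]. *)
Definition eventually (P : seq M -> Prop) :=
  exists F0 : seq M, forall F, {subset F0 <= F} -> P F.

Lemma eventually_all (P : seq M -> Prop) : (forall F, P F) -> eventually P.
Proof. by exists [::]. Qed.

Lemma eventually2 (P Q R : seq M -> Prop) :
  (forall F, P F -> Q F -> R F) -> eventually P -> eventually Q ->
  eventually R.
Proof.
move=> PQR [F1 H1] [F2 H2]; exists (F1 ++ F2) => F sF.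
by apply: PQR; [apply: H1|apply: H2] => x xF; apply: sF;
  rewrite mem_cat xF ?orbT.
Qed.

Lemma eventually1 (P R : seq M -> Prop) :
  (forall F, P F -> R F) -> eventually P -> eventually R.
Proof. by move=> PR evP; exact: (eventually2 (fun F p _ => PR F p) evP evP). Qed.

Definition approx_delta (F : seq M) : M :=
  foldr (fun y e => (y `|` (y `=>` b)) `&` e) ph_top F.

Lemma approx_delta_ge F : b <= approx_delta F.
Proof.
elim: F => [|y F IH] /=; first exact: ph_lex1.
apply/ph_lexI; split=> //; apply: ph_trans (ph_leUr _ _).
by apply/ph_le_imp.
Qed.

Lemma approx_delta_imp F : (approx_delta F `=>` b) <= b.
Proof.
(* The bound [z] varies, so that the induction can pass to smaller elements. *)
suff H z : (forall w, w <= z -> w <= approx_delta F -> w <= b) -> z <= b.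
  by apply: H; apply/ph_le_imp; exact: ph_refl.
elim: F z => [|y F IH] z /= zP.
  by apply: zP; [exact: ph_refl|exact: ph_lex1].
apply: IH => w wz wF; apply: (zP) => //; apply/ph_lexI; split=> //.
(* The right disjunct [y -> b] holds at [w]: any [v] below [w] and [y] satisfies the left disjunct,
   so [zP] already puts it below [b]. *)
apply: ph_trans (ph_leUr _ _); apply/ph_le_imp => v vw vy.
apply: zP; first exact: ph_trans wz.
apply/ph_lexI; split; last exact: ph_trans wF.
exact: ph_trans (ph_leUl _ _).
Qed.

Lemma approx_delta_le F y : y \in F -> approx_delta F <= y `|` (y `=>` b).
Proof.
elim: F => //= z F IH; rewrite inE => /orP[/eqP->|/IH yF].
  exact: ph_leIl.
exact: ph_trans (ph_leIr _ _) yF.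
Qed.

(** * The subalgebra of the reduced power *)

Definition adj_pred (x : seq M -> M) :=
  exists h, eventually (fun F => ph_agree (approx_delta F) (x F) h).

Definition adj_sort := {x : seq M -> M | adj_pred x}.
Implicit Types x y z : adj_sort.

Definition adj_fun (x : adj_sort) : seq M -> M := sval x.

Definition adj_le x y := eventually (fun F => adj_fun x F <= adj_fun y F).

Fact adj_meetP x y : adj_pred (fun F => adj_fun x F `&` adj_fun y F).
Proof.
have [h xh] := svalP x; have [k yk] := svalP y; exists (h `&` k).
by apply: eventually2 xh yk => F; exact: ph_agreeI.
Qed.

Fact adj_joinP x y : adj_pred (fun F => adj_fun x F `|` adj_fun y F).
Proof.
have [h xh] := svalP x; have [k yk] := svalP y; exists (h `|` k).
by apply: eventually2 xh yk => F; exact: ph_agreeU.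
Qed.

Fact adj_impP x y : adj_pred (fun F => adj_fun x F `=>` adj_fun y F).
Proof.
have [h xh] := svalP x; have [k yk] := svalP y; exists (h `=>` k).
by apply: eventually2 xh yk => F; exact: ph_agree_imp.
Qed.

Fact adj_cstP (h : M) : adj_pred (fun=> h).
Proof. by exists h; apply: eventually_all => F; exact: ph_agree_refl. Qed.

(** Modulo its own filter, [approx_delta F] is the top element. *)
Fact adj_newP : adj_pred approx_delta.
Proof. by exists ph_top; apply: eventually_all => F; exact: ph_agree_top. Qed.

Definition adj_meet x y : adj_sort := exist adj_pred _ (adj_meetP x y).
Definition adj_join x y : adj_sort := exist adj_pred _ (adj_joinP x y).
Definition adj_imp x y : adj_sort := exist adj_pred _ (adj_impP x y).
Definition adj_cst h : adj_sort := exist adj_pred _ (adj_cstP h).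
Definition adj_new : adj_sort := exist adj_pred _ adj_newP.

Fact adj_refl x : adj_le x x.
Proof. by apply: eventually_all => F; exact: ph_refl. Qed.

Fact adj_trans y x z : adj_le x y -> adj_le y z -> adj_le x z.
Proof. by apply: eventually2 => F; exact: ph_trans. Qed.

Fact adj_lexI x y z : adj_le x (adj_meet y z) <-> adj_le x y /\ adj_le x z.
Proof.
split=> [H|[]]; last by apply: eventually2 => F xy xz; apply/ph_lexI.
by split; apply: eventually1 H => F /ph_lexI[].
Qed.

Fact adj_leUx x y z : adj_le (adj_join x y) z <-> adj_le x z /\ adj_le y z.
Proof.
split=> [H|[]]; last by apply: eventually2 => F xz yz; apply/ph_leUx.
by split; apply: eventually1 H => F /ph_leUx[].
Qed.

Fact adj_leIimp x y z : adj_le (adj_meet x y) z <-> adj_le x (adj_imp y z).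
Proof. by split; apply: eventually1 => F /ph_leIimp. Qed.

Fact adj_le0x x : adj_le (adj_cst ph_bot) x.
Proof. by apply: eventually_all => F; exact: ph_le0x. Qed.

Fact adj_lex1 x : adj_le x (adj_cst ph_top).
Proof. by apply: eventually_all => F; exact: ph_lex1. Qed.

Definition adjoin : preheyting :=
  PreHeyting adj_refl adj_trans adj_lexI adj_leUx adj_leIimp adj_le0x adj_lex1.

Lemma adj_cst_le (h k : M) : adj_le (adj_cst h) (adj_cst k) <-> h <= k.
Proof.
by split=> [[F0 /(_ F0)]|hk]; [exact | exact: eventually_all].
Qed.

(** This and the next two are equalities, not mere equivalences, so that evaluations of terms can be
    rewritten. *)
Lemma adj_cstI h k : adj_cst (h `&` k) = adj_meet (adj_cst h) (adj_cst k).
Proof. by congr exist; exact: Prop_irrelevance. Qed.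

Lemma adj_cstU h k : adj_cst (h `|` k) = adj_join (adj_cst h) (adj_cst k).
Proof. by congr exist; exact: Prop_irrelevance. Qed.

Lemma adj_cst_imp h k : adj_cst (h `=>` k) = adj_imp (adj_cst h) (adj_cst k).
Proof. by congr exist; exact: Prop_irrelevance. Qed.

Lemma adj_new_is_delta : @is_delta adjoin (adj_cst b) adj_new.
Proof.
split=> [||x].
- by apply: eventually_all => F; exact: approx_delta_ge.
- by apply: eventually_all => F; exact: approx_delta_imp.
- have [h xh] := svalP x.
  (* The witness [h] is a single element of [M], so its factor eventually occurs in
     [approx_delta F]; agreement carries the bound from [h] to [x]. *)
  have h_in : eventually (fun F => h \in F).
    by exists [:: h] => F; apply; rewrite mem_head.
  by apply: eventually2 xh h_in => F xh /approx_delta_le; exact: ph_agree_cover.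
Qed.

Lemma adj_cst_is_delta (a d : M) :
  is_delta a d -> @is_delta adjoin (adj_cst a) (adj_cst d).
Proof. by case=> ad da dP; split=> [||x]; apply: eventually_all => F //=. Qed.

(** Evaluation is coordinatewise, so inequalities between terms valid in [M] pass to the
    extension. *)
Lemma adj_teval A (c : A -> adjoin) (dl : kmterm A -> adjoin) F t :
  adj_fun (teval c dl t) F =
  teval (fun a => adj_fun (c a) F) (fun s => adj_fun (dl s) F) t.
Proof. by elim: t => //= t <- s <-. Qed.

End Adjoin.

(** * Models of finitely many Delta-axioms *)

Section Models.
Variables (d : Order.disp_t) (H : heytingType d).
Local Notation term := (kmterm H).

Fact ph_heyting_lexI (x y z : H) :
  (x <= y `&` z)%O <-> (x <= y)%O /\ (x <= z)%O.
Proof. by rewrite lexI; split=> [/andP|/andP]. Qed.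

Fact ph_heyting_leUx (x y z : H) :
  (x `|` y <= z)%O <-> (x <= z)%O /\ (y <= z)%O.
Proof. by rewrite leUx; split=> [/andP|/andP]. Qed.

Fact ph_heyting_leIimp (x y z : H) :
  (x `&` y <= z)%O <-> (x <= (y `=>` z))%O.
Proof. by rewrite leIhimp. Qed.

Definition ph_heyting : preheyting :=
  @PreHeyting H (fun x y => (x <= y)%O) Order.meet Order.join himp \bot \top
    (@lexx _ H) (@le_trans _ H) ph_heyting_lexI ph_heyting_leUx
    ph_heyting_leIimp (@le0x _ H) (@lex1 _ H).

Local Notation evalH c dl := (@teval H ph_heyting c dl).

(** Both [Cst a] and [Dlt t] are read as free variables: [c] and [dl] are arbitrary maps, and [p],
    [q] act as plain Heyting terms. *)
Definition satisfies_identities (M : preheyting) := forall p q : term,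
  (forall (c : H -> H) (dl : term -> H), (evalH c dl p <= evalH c dl q)%ph) ->
  forall (c : H -> M) (dl : term -> M), teval c dl p <= teval c dl q.

Record ph_hom (M : preheyting) (c : H -> M) : Prop := PhHom {
  ph_homI : forall x y : H, ph_eqv (c (x `&` y)%O) (c x `&` c y);
  ph_homU : forall x y : H, ph_eqv (c (x `|` y)%O) (c x `|` c y);
  ph_hom_imp : forall x y : H, ph_eqv (c (x `=>` y)%O) (c x `=>` c y);
  ph_hom0 : ph_eqv (c \bot%O) ph_bot;
  ph_hom1 : ph_eqv (c \top%O) ph_top
}.

Record model (M : preheyting) (c : H -> M) (dl : term -> M) (L : seq term) :
    Prop := Model {
  model_identities : satisfies_identities M;
  model_hom : ph_hom c;
  model_delta : forall t, t \in L -> is_delta (teval c dl t) (dl t)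
}.

Lemma model_sub M c dl (L L' : seq term) :
  {subset L <= L'} -> @model M c dl L' -> @model M c dl L.
Proof. by move=> sLL' [ids hom dlP]; split=> // t /sLL'; exact: dlP. Qed.

Lemma adjoin_satisfies_identities (M : preheyting) (b : M) :
  satisfies_identities M -> satisfies_identities (adjoin b).
Proof.
move=> ids p q pq c dl; apply: eventually_all => F.
by rewrite !adj_teval; exact: ids.
Qed.

Lemma adjoin_hom (M : preheyting) (b : M) (c : H -> M) :
  ph_hom c -> @ph_hom (adjoin b) (fun x => adj_cst b (c x)).
Proof.
have cst_eqv h k : ph_eqv h k -> @ph_eqv (adjoin b) (adj_cst b h) (adj_cst b k).
  by case=> hk kh; split; exact/adj_cst_le.
case=> cI cU ci c0 c1; split=> [x y|x y|x y||]; last 2 first.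
- exact: cst_eqv.
- exact: cst_eqv.
- by rewrite /= -adj_cstI; exact: cst_eqv.
- by rewrite /= -adj_cstU; exact: cst_eqv.
- by rewrite /= -adj_cst_imp; exact: cst_eqv.
Qed.

(* The Delta-axioms are added by increasing size of the term, so that the new
   value of [Dlt t] does not affect the terms treated before. *)
Lemma model_step (M : preheyting) c dl (L : seq term) (t : term) :
    {in L, forall s, (tsize s <= tsize t)%N} ->
    @model M c dl L -> (forall x y, c x <= c y -> (x <= y)%O) ->
  exists (M' : preheyting) c' dl',
    @model M' c' dl' (t :: L) /\ forall x y, c' x <= c' y -> (x <= y)%O.
Proof.
move=> leLt [ids hom dlP] c_refl.
have [tL|tNL] := boolP (t \in L).
  exists M, c, dl; split=> //; split=> // s.
  by rewrite inE => /orP[/eqP->|]; exact: dlP.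
pose b := teval c dl t.
pose c' x : adjoin b := adj_cst b (c x).
pose dl' s : adjoin b := if s == t then adj_new b else adj_cst b (dl s).
(* By size, [Dlt t] does not occur in such an [s], so its evaluation only sees transported
   values. *)
have evE s : (tsize s <= tsize t)%N ->
    teval c' dl' s = adj_cst b (teval c dl s).
  elim: s => [a|s _|s IHs r IHr|s IHs r IHr|s IHs r IHr||] //=.
  - by move=> lt_st; rewrite /dl'; case: eqP => // st; rewrite st ltnn in lt_st.
  - by rewrite geq_max => /andP[/IHs-> /IHr->]; rewrite adj_cstI.
  - by rewrite geq_max => /andP[/IHs-> /IHr->]; rewrite adj_cstU.
  - by rewrite geq_max => /andP[/IHs-> /IHr->]; rewrite adj_cst_imp.
exists (adjoin b), c', dl'; split=> [|x y /adj_cst_le/c_refl//].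
split=> [||s]; first exact: adjoin_satisfies_identities.
- exact: adjoin_hom.
- rewrite inE => /predU1P[->|sL].
    by rewrite evE // /dl' eqxx; exact: adj_new_is_delta.
  rewrite evE ?leLt // /dl'; case: eqP => [st|_]; first by rewrite -st sL in tNL.
  by apply: adj_cst_is_delta; exact: dlP.
Qed.

Lemma model_exists (L : seq term) :
  exists (M : preheyting) c dl,
    @model M c dl L /\ forall x y, c x <= c y -> (x <= y)%O.
Proof.
(* Decreasing order: the induction on the list adds its head last, so the head must be largest. *)
pose geT (s t : term) := (tsize t <= tsize s)%N.
have geT_trans : transitive geT by move=> t s r st tr; exact: leq_trans tr st.
have geT_total : total geT by move=> s t; exact: leq_total.
suff sorted_model L' : sorted geT L' ->
    exists (M : preheyting) c dl,
      @model M c dl L' /\ forall x y, c x <= c y -> (x <= y)%O.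
  have [M [c [dl [mod c_refl]]]] := sorted_model _ (sort_sorted geT_total L).
  exists M, c, dl; split=> //; apply: model_sub mod => t.
  by rewrite mem_sort.
elim: L' => [_|t L' IH] /=.
  (* With no axiom imposed, [H] itself is a model; the value [\bot] is arbitrary. *)
  exists ph_heyting, id, (fun=> \bot%O); split=> //; split=> //.
  by split=> *; exact: ph_eqv_refl.
rewrite path_sortedE // => /andP[/allP ge_t /IH[M [c [dl [mod c_refl]]]]].
exact: model_step mod c_refl.
Qed.

(** * The KM-algebra of terms *)

(** Compactness is built in: each inequality rests on a finite list [L], and two inequalities are
    combined by concatenating their lists. *)
Definition term_le (p q : term) := exists L : seq term,
  forall (M : preheyting) c dl, @model M c dl L -> teval c dl p <= teval c dl q.

Lemma term_le_all (p q : term) :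
  (forall (M : preheyting) c dl L, @model M c dl L ->
     teval c dl p <= teval c dl q) ->
  term_le p q.
Proof. by move=> pq; exists [::] => M c dl; exact: pq. Qed.

Lemma term_le2 (p q p' q' p'' q'' : term) :
  (forall (M : preheyting) c dl L, @model M c dl L ->
     teval c dl p <= teval c dl q -> teval c dl p' <= teval c dl q' ->
     teval c dl p'' <= teval c dl q'') ->
  term_le p q -> term_le p' q' -> term_le p'' q''.
Proof.
move=> pq [L1 H1] [L2 H2]; exists (L1 ++ L2) => M c dl mod.
apply: (pq _ _ _ _ mod); [apply: H1|apply: H2]; apply: model_sub mod => t tL;
  by rewrite mem_cat tL ?orbT.
Qed.

Lemma term_le1 (p q p' q' : term) :
  (forall (M : preheyting) c dl L, @model M c dl L ->
     teval c dl p <= teval c dl q -> teval c dl p' <= teval c dl q') ->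
  term_le p q -> term_le p' q'.
Proof.
move=> pq le_pq; apply: (term_le2 _ le_pq le_pq) => M c dl L mod H1 _.
exact: pq mod H1.
Qed.

Fact term_refl p : term_le p p.
Proof. by apply: term_le_all => *; exact: ph_refl. Qed.

Fact term_trans q p r : term_le p q -> term_le q r -> term_le p r.
Proof. by apply: term_le2 => M c dl L _; exact: ph_trans. Qed.

Fact term_lexI p q r : term_le p (Meet q r) <-> term_le p q /\ term_le p r.
Proof.
split=> [pqr|[]]; last by apply: term_le2 => M c dl L _ pq pr; apply/ph_lexI.
by split; apply: term_le1 pqr => M c dl L _ /ph_lexI[].
Qed.

Fact term_leUx p q r : term_le (Join p q) r <-> term_le p r /\ term_le q r.
Proof.
split=> [pqr|[]]; last by apply: term_le2 => M c dl L _ pr qr; apply/ph_leUx.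
by split; apply: term_le1 pqr => M c dl L _ /ph_leUx[].
Qed.

Fact term_leIimp p q r : term_le (Meet p q) r <-> term_le p (Imp q r).
Proof. by split; apply: term_le1 => M c dl L _ /ph_leIimp. Qed.

Fact term_le0x p : term_le Bot p.
Proof. by apply: term_le_all => *; exact: ph_le0x. Qed.

Fact term_lex1 p : term_le p Top.
Proof. by apply: term_le_all => *; exact: ph_lex1. Qed.

Definition ph_term : preheyting :=
  PreHeyting term_refl term_trans term_lexI term_leUx term_leIimp
    term_le0x term_lex1.

(** The one-element list [[:: p]] forces all three conditions, for every [y] at once. *)
Lemma term_is_delta p : @is_delta ph_term p (Dlt p).
Proof.
have delta_p M c dl : @model M c dl [:: p] -> is_delta (teval c dl p) (dl p).
  by move=> mod; apply: (model_delta mod); rewrite inE.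
by split=> [||y]; exists [:: p] => M c dl /delta_p[? ? cover]; last exact: cover.
Qed.

Definition km_quot : Type := ph_quot_of ph_term d.
HB.instance Definition _ := Heyting.on km_quot.

Definition km_pi (t : term) : km_quot := @ph_pi d ph_term t.
Definition km_repr (x : km_quot) : term := @ph_repr d ph_term x.

Lemma km_reprK x : km_pi (km_repr x) = x.
Proof. exact: ph_reprK. Qed.

Lemma km_pi_eq p q : term_le p q -> term_le q p -> km_pi p = km_pi q.
Proof. by move=> pq qp; apply/ph_piP. Qed.

Lemma le_km_pi p q : (km_pi p <= km_pi q)%O = `[< term_le p q >].
Proof. exact: le_ph_pi. Qed.

Lemma km_piI p q : km_pi (Meet p q) = (km_pi p `&` km_pi q)%O.
Proof. exact: ph_piI. Qed.

Lemma km_piU p q : km_pi (Join p q) = (km_pi p `|` km_pi q)%O.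
Proof. exact: ph_piU. Qed.

Lemma km_pi_imp p q : km_pi (Imp p q) = (km_pi p `=>` km_pi q)%O.
Proof. exact: ph_pi_imp. Qed.

(** The axioms hold for [Dlt p] at every term [p], so any choice of representatives yields a KM
    operation. *)
Definition km_delta (x : km_quot) : km_quot := km_pi (Dlt (km_repr x)).

Fact km_le_delta x : (x <= km_delta x)%O.
Proof.
rewrite -{1}(km_reprK x) le_km_pi; apply/asboolP.
by have [] := term_is_delta (km_repr x).
Qed.

Fact km_delta_himp x : (km_delta x `=>` x)%O = x.
Proof.
have {2 3}<- := km_reprK x; rewrite -km_pi_imp; apply: km_pi_eq.
  by have [] := term_is_delta (km_repr x).
exact/(@ph_le_imp ph_term).
Qed.

Fact km_delta_le x y : (km_delta x <= y `|` (y `=>` x))%O.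
Proof.
rewrite -(km_reprK y) -{2}(km_reprK x) -km_pi_imp -km_piU le_km_pi.
by apply/asboolP; have [_ _ /(_ (km_repr y))] := term_is_delta (km_repr x).
Qed.

HB.instance Definition _ :=
  Heyting_isKM.Build d km_quot km_le_delta km_delta_himp km_delta_le.

(** * The embedding of [H] *)

Definition km_embed (x : H) : km_quot := km_pi (Cst x).

Lemma km_embed_hom : heyting_hom km_embed.
Proof.
split=> [x y|x y|x y||]; rewrite /km_embed -?km_piI -?km_piU -?km_pi_imp;
  apply: km_pi_eq; apply: term_le_all => M c dl L /model_hom[cI cU ci c0 c1] /=.
- by have [] := cI x y.
- by have [] := cI x y.
- by have [] := cU x y.
- by have [] := cU x y.
- by have [] := ci x y.
- by have [] := ci x y.
- by have [] := c0.
- by have [] := c0.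
- by have [] := c1.
- by have [] := c1.
Qed.

(** An inequality between constants rests on some finite [L]; a model of [L] that reflects the order
    of [H] brings it back to [H]. *)
Lemma km_embed_inj : injective km_embed.
Proof.
have embed_le x y : (km_embed x <= km_embed y)%O -> (x <= y)%O.
  rewrite le_km_pi => /asboolP[L le_xy].
  have [M [c [dl [mod c_refl]]]] := model_exists L.
  by apply: c_refl; exact: le_xy mod.
by move=> x y xy; apply: le_anti; rewrite !embed_le ?xy.
Qed.

(** * Membership in the variety generated by [H] *)

Definition term_fun (p : term) : (H -> H) * (term -> H) -> H :=
  fun v => evalH v.1 v.2 p.

(** The free algebra of the variety on the variables [Cst a] and [Dlt t], realised inside the power
    of [H] indexed by valuations. *)
Definition term_funs : {pred (H -> H) * (term -> H) -> H} :=
  fun f => `[< exists p, f = term_fun p >].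

Lemma term_fun_in p : term_fun p \in term_funs.
Proof. by apply/asboolP; exists p. Qed.

Lemma term_funsP f : f \in term_funs -> exists p, f = term_fun p.
Proof. by move/asboolP. Qed.

Lemma term_funs_closed : heyting_closed term_funs.
Proof.
split=> [f g|f g|f g||].
- by move=> /term_funsP[p ->] /term_funsP[q ->]; exact: (term_fun_in (Meet p q)).
- by move=> /term_funsP[p ->] /term_funsP[q ->]; exact: (term_fun_in (Join p q)).
- by move=> /term_funsP[p ->] /term_funsP[q ->]; exact: (term_fun_in (Imp p q)).
- exact: (term_fun_in Bot).
- exact: (term_fun_in Top).
Qed.

(** Equal term functions amount to an identity of [H], which every model satisfies; hence the
    quotient map factors through [term_funs]. *)
Lemma km_pi_term_fun p q : term_fun p = term_fun q -> km_pi p = km_pi q.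
Proof.
move=> pq; have {pq} pq c dl : evalH c dl p = evalH c dl q.
  by have := congr1 (fun f => f (c, dl)) pq.
apply: km_pi_eq; apply: term_le_all => M c dl L /model_identities; apply=> c' dl';
  by rewrite pq; exact: ph_refl.
Qed.

Definition term_fun_class (f : subalgebra term_funs_closed) : km_quot :=
  km_pi (sval (cid (term_funsP (valP f)))).

Lemma term_fun_classE f p : val f = term_fun p -> term_fun_class f = km_pi p.
Proof.
by move=> fp; apply: km_pi_term_fun; rewrite -fp; case: cid => q /= <-.
Qed.

Lemma km_quot_in_variety : in_variety_generated_by H km_quot.
Proof.
exists ((H -> H) * (term -> H))%type, term_funs, term_funs_closed.
exists term_fun_class; split; last first.
  move=> y; exists (exist (fun f => f \in term_funs) _ (term_fun_in (km_repr y))).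
  by rewrite (term_fun_classE (p := km_repr y)) // km_reprK.
have repr (f : subalgebra term_funs_closed) : exists p, val f = term_fun p.
  exact: term_funsP (valP f).
split=> [f g|f g|f g||].
- have [[p fp] [q gq]] := (repr f, repr g).
  rewrite (term_fun_classE fp) (term_fun_classE gq) -km_piI.
  by apply: term_fun_classE; rewrite subalgebra_valI fp gq.
- have [[p fp] [q gq]] := (repr f, repr g).
  rewrite (term_fun_classE fp) (term_fun_classE gq) -km_piU.
  by apply: term_fun_classE; rewrite subalgebra_valU fp gq.
- have [[p fp] [q gq]] := (repr f, repr g).
  rewrite (term_fun_classE fp) (term_fun_classE gq) -km_pi_imp.
  by apply: term_fun_classE; rewrite /= fp gq.
- exact: (term_fun_classE (p := Bot)).
- exact: (term_fun_classE (p := Top)).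
Qed.

End Models.

Theorem theorem4p3 (d : Order.disp_t) (H : heytingType d) :
  exists (K : kmType d) (f : H -> K),
    heyting_hom f /\ injective f /\ in_variety_generated_by H K.
Proof.
exists (km_quot H), (@km_embed d H); split; first exact: km_embed_hom.
by split; [exact: km_embed_inj | exact: km_quot_in_variety].
Qed.
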